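(* For every integer $n\ge 0$, $y^{3^n}Z_n(y)$ is a polynomial in $\mathbb{Z}[y^4]$. Further, if $M_n$ is defined by $$M_n(y^4):=\frac{y^{3^n}Z_n(y)}{2},$$ then $M_n(x)\in\mathbb{Z}[x]$ for every $n\ge 0$, and for every $n\ge 1$ $$M_n(x)=M_{n-1}(f(x))\,[(x+1)(x+3)]^{3^{n-1}},\qquad\text{where } f(x):=\frac{x^2-x+4}{x+3}.$$
   Context: Sierpinski gasket graphs: $\mathcal{G}_0$ is a triangle (three vertices, three edges), whose three vertices are its external corners. For $n\ge 1$, $\mathcal{G}_n$ is obtained from three copies of $\mathcal{G}_{n-1}$ by joining them at their external corners: for each pair of copies, one external corner of one copy is identified with one external corner of the other, the three identifications using six distinct corners; the three remaining unidentified corners are the external corners of $\mathcal{G}_n$. Ising model: for a finite graph with vertex set $\mathcal{V}$ and edge set $\mathcal{E}$, a spin configuration is a map $\sigma:\mathcal{V}\to\{\pm1\}$; its Hamiltonian is $H(\sigma)=-J\sum_{\langle v,w\rangle\in\mathcal{E}}\sigma(v)\sigma(w)$ with $J>0$ constant (each edge counted once); its Gibbs weight is $W(\sigma)=e^{-H(\sigma)/T}$ with temperature $T>0$. Put $y=e^{J/T}$. The partition function $Z_n$ is the sum of $W(\sigma)$ over all spin configurations $\sigma$ on $\mathcal{G}_n$, written as a function of $y$; equivalently $$Z_n(y)=\sum_{\sigma}y^{\sum_{\langle v,w\rangle}\sigma(v)\sigma(w)},$$ a Laurent polynomial in $y$. For example $Z_0(y)=2y^3+6y^{-1}$. *)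

(* Defs.v *)
From HB Require Import structures.
From mathcomp Require Import all_boot all_order all_algebra.
From mathcomp Require Import generic_quotient.
From mathcomp Require Import reals sequences exp.

Set Implicit Arguments.
Unset Strict Implicit.
Unset Printing Implicit Defensive.
Import GRing.Theory Num.Theory.

Local Open Scope ring_scope.
Local Open Scope quotient_scope.

(* Finite simple graphs with three distinct marked vertices (the external
   corners).  An edge is the set of its two endpoints. *)
Record cgraph := CGraph {
  vertex : finType;
  edges : {set {set vertex}};
  corner : 'I_3 -> vertex;
  edges_card2 : forall e, e \in edges -> #|e| = 2%N;
  corner_inj : injective corner }.

Lemma triangle_card2 (e : {set 'I_3}) :
  e \in [set e : {set 'I_3} | #|e| == 2%N] -> #|e| = 2%N.
Proof. by rewrite inE => /eqP. Qed.

Definition triangle : cgraph :=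
  CGraph triangle_card2 (@inj_id _).

(* In three copies of G, the pair (i, v) is the vertex v of copy i.  For i != j,
   corner j of copy i is identified with corner i of copy j; thus the corners
   that stay free are corner i of copy i, for i = 0, 1, 2. *)
Definition glue (G : cgraph) : rel ('I_3 * vertex G) :=
  fun p q => (p == q) ||
    [&& p.1 != q.1, p.2 == corner G q.1 & q.2 == corner G p.1].

Lemma glue_refl (G : cgraph) : reflexive (@glue G).
Proof. by move=> p; rewrite /glue eqxx. Qed.

Lemma glue_sym (G : cgraph) : symmetric (@glue G).
Proof.
by move=> p q; rewrite /glue eq_sym [p.1 == _]eq_sym [(p.2 == _) && _]andbC.
Qed.

Lemma glue_trans (G : cgraph) : transitive (@glue G).
Proof.
move=> [j v] [i u] [k w] /orP[/eqP-> //|/and3P[/= nij /eqP -> /eqP ->]].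
case/orP=> [/eqP<-|/and3P[/= njk /eqP/corner_inj -> /eqP ->]].
  by rewrite /glue /= nij !eqxx orbT.
exact: glue_refl.
Qed.

Canonical glue_equiv (G : cgraph) :=
  EquivRel (@glue G) (@glue_refl G) (@glue_sym G) (@glue_trans G).

Definition join_vertex (G : cgraph) : finType :=
  quot_type {eq_quot (@glue G)}.

Definition in_copy (G : cgraph) (i : 'I_3) (v : vertex G) : join_vertex G :=
  \pi_{eq_quot (@glue G)} (i, v).

Definition join_edges (G : cgraph) : {set {set join_vertex G}} :=
  [set in_copy i @: e | i : 'I_3, e : {set vertex G} in edges G].

Definition join_corner (G : cgraph) (i : 'I_3) : join_vertex G :=
  in_copy i (corner G i).

Lemma in_copy_inj (G : cgraph) (i : 'I_3) : injective (@in_copy G i).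
Proof.
move=> u v /eqmodP; rewrite /= /glue /= eqxx /= orbF.
by move=> /eqP[].
Qed.

Lemma join_edges_card2 (G : cgraph) (e : {set join_vertex G}) :
  e \in join_edges G -> #|e| = 2%N.
Proof.
case/imset2P=> i e' _ e'G ->.
by rewrite (card_imset _ (@in_copy_inj G i)) (edges_card2 e'G).
Qed.

Lemma join_corner_inj (G : cgraph) : injective (@join_corner G).
Proof.
move=> i j /eqmodP; rewrite /= /glue /= => /orP[/eqP[] //|].
by case/and3P=> nij /eqP/corner_inj eij; rewrite eij eqxx in nij.
Qed.

Definition join3 (G : cgraph) : cgraph :=
  CGraph (@join_edges_card2 G) (@join_corner_inj G).

Fixpoint sierpinski (n : nat) : cgraph :=
  if n is m.+1 then join3 (sierpinski m) else triangle.

Definition config (G : cgraph) := {ffun vertex G -> bool}.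

Definition spin (b : bool) : int := if b then 1 else -1.

Definition spin_sum (G : cgraph) (s : config G) : int :=
  \sum_(e in edges G) \prod_(v in e) spin (s v).

(* The partition function at y; with F a field of rational functions and y its
   indeterminate this is the partition function as a Laurent polynomial. *)
Definition partition_function (F : fieldType) (G : cgraph) (y : F) : F :=
  \sum_(s : config G) y ^ spin_sum s.

Definition gasketZ (F : fieldType) (n : nat) (y : F) : F :=
  partition_function (sierpinski n) y.

Definition hamiltonian (R : realType) (J : R) (G : cgraph) (s : config G) : R :=
  - J * (spin_sum s)%:~R.

Definition gibbs_weight (R : realType) (J T : R) (G : cgraph) (s : config G) : R :=
  expR (- hamiltonian J s / T).

Lemma partition_function_gibbs (R : realType) (J T : R) (G : cgraph) :
  \sum_(s : config G) gibbs_weight J T s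
    = partition_function G (expR (J / T)).
Proof.
apply: eq_bigr => s _; rewrite /gibbs_weight /hamiltonian.
rewrite [- J * _]mulNr opprK mulrAC.
case: (spin_sum s) => m.
  by rewrite -exprnP -expRM_natl mulrC.
by rewrite NegzE mulrNz mulrN expRN -exprnN -expRM_natl mulrC.
Qed.

Notation ratfun := {fraction {poly rat}}.

Definition indet : ratfun := tofrac 'X.

(* Substitution p(r) of a rational function r in a polynomial p. *)
Definition ratsubst (p : {poly rat}) (r : ratfun) : ratfun :=
  (map_poly (@tofrac {poly rat} \o polyC) p).[r].

(* Main.v *)
(* Let A_n (resp. B_n) be the sum of the weights of the configurations on G_n
   whose corner spins are three prescribed equal (resp. unequal) values, so that
   Z_n = 2 A_n + 6 B_n.  Summing over the spins of the three glued vertices gives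
     A_n = A^3 + 3 A B^2 + 4 B^3 = (A + B)(A^2 - A B + 4 B^2),
     B_n = A^2 B + 4 A B^2 + 3 B^3 = B (A + B)(A + 3 B)
   where A = A_(n-1), B = B_(n-1).  Hence Z_n = 2 h_n(y^3, y^-1) for an integral
   form h_n of degree 3^n, so y^(3^n) Z_n = 2 h_n(y^4, 1) and M_n = h_n(x, 1);
   one step of the recursion sends A / B to f(A / B) and (x, 1) to
   (x + 1)(x + 3) (f(x), 1). *)

Require Import Defs.
From mathcomp Require Import all_boot all_order all_algebra generic_quotient ring.

Set Implicit Arguments.
Unset Strict Implicit.
Unset Printing Implicit Defensive.
Import GRing.Theory Num.Theory.
Local Open Scope ring_scope.
Local Open Scope quotient_scope.

(** * Vertices, edges and configurations of the join *)

Lemma in_copyP (G : cgraph) i j (u v : vertex G) :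
  (in_copy i u == in_copy j v) =
  ((i == j) && (u == v)) || [&& i != j, u == corner G j & v == corner G i].
Proof.
rewrite -xpair_eqE -/(glue (i, u) (j, v)).
by apply/eqP/idP => [/eqmodP|uv] //; apply/eqmodP.
Qed.

(* Distinct copies share a single vertex, while an edge has two. *)
Lemma in_copy_edge_inj (G : cgraph) :
  {in setX setT (edges G) &,
    injective (fun p : 'I_3 * {set vertex G} => in_copy p.1 @: p.2)}.
Proof.
move=> [i d] [j e]; rewrite !inE /= => dG eG eqde.
have [eij|nij] := eqVneq i j.
  by move: eqde; rewrite eij => /(imset_inj (@in_copy_inj G j)) ->.
suff: (#|d| <= 1)%N by rewrite (edges_card2 dG).
rewrite -(cards1 (corner G j)); apply/subset_leq_card/subsetP => u ud.
have : in_copy i u \in in_copy j @: e by rewrite -eqde imset_f.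
case/imsetP => v _ /eqP; rewrite in_copyP (negPf nij) /= => /andP[/eqP-> _].
by rewrite inE.
Qed.

Definition restrict (G : cgraph) (s : config (join3 G)) : {ffun 'I_3 -> config G} :=
  [ffun i => [ffun v => s (in_copy i v)]].

(** The spin at a glued vertex is read off from the representative that [repr] picks, so this
    extends every [f i] only if the three configurations agree at identified corners. *)
Definition amalgam (G : cgraph) (f : {ffun 'I_3 -> config G}) : config (join3 G) :=
  [ffun w : join_vertex G => f (repr w).1 (repr w).2].

Lemma restrictK (G : cgraph) : cancel (@restrict G) (@amalgam G).
Proof.
move=> s; apply/ffunP => w; rewrite !ffunE /in_copy -surjective_pairing.
by rewrite reprK.
Qed.

Lemma amalgamE (G : cgraph) (f : {ffun 'I_3 -> config G}) i v :
  (forall i j, f i (corner G j) = f j (corner G i)) ->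
  amalgam f (in_copy i v) = f i v.
Proof.
move=> fC; rewrite ffunE; set p := repr _.
have : in_copy p.1 p.2 == in_copy i v.
  by rewrite {1}/in_copy -surjective_pairing reprK.
rewrite in_copyP => /orP[/andP[/eqP-> /eqP->]//|/and3P[_ /eqP-> /eqP->]].
exact: fC.
Qed.

(** By [in_copy_edge_inj] no edge of the join comes from two copies, so the sum over its edges
    splits. *)
Lemma spin_sum_join (G : cgraph) (s : config (join3 G)) :
  spin_sum s = \sum_i spin_sum (restrict s i).
Proof.
have joinE : join_edges G =
    [set in_copy p.1 @: p.2 | p : ('I_3 * {set vertex G}) in setX setT (edges G)].
  apply/setP => e; apply/imset2P/imsetP => [[i d _ dG ->]|[[i d]]].
    by exists (i, d); rewrite // !inE.
  by rewrite !inE /= => dG ->; exists i d.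
rewrite /spin_sum /= joinE big_imset /=; last exact: in_copy_edge_inj.
rewrite pair_big_dep /=; apply: eq_big => [p|p _]; first by rewrite !inE.
rewrite (big_imset (fun v : join_vertex G => spin (s v))) /=; last first.
  by move=> u v _ _ /in_copy_inj.
by apply: eq_bigr => v _; rewrite !ffunE.
Qed.

(** Indexing an edge by its opposite vertex turns sums over edges into sums over ['I_3]. *)
Lemma edges_triangle : edges triangle = [set ~: [set i] | i : 'I_3].
Proof.
apply/setP => e; rewrite inE; apply/idP/imsetP => [/eqP e2|[i _ ->]]; last first.
  by rewrite -(eqn_add2l #|[set i]|) cardsC cards1 card_ord.
have /cards1P[i ei] : #|~: e| == 1%N.
  by rewrite -(eqn_add2l #|e|) cardsC e2 card_ord.
by exists i; rewrite // -ei setCK.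
Qed.

Definition tri (a b c : bool) (i : 'I_3) : bool := nth false [:: a; b; c] i.

Lemma forall_tri (p : 'I_3 -> bool) (a b c : bool) :
  [forall j, p j == tri a b c j] =
  [&& p 0 == a, p 1 == b & p (inord 2) == c].
Proof.
apply/forallP/and3P => [h|[/eqP<- /eqP<- /eqP<-] [[|[|[|]]] // lti]].
- move: (h 0) (h 1) (h (inord 2)); rewrite /tri /= inordK //.
- by rewrite /tri /=; apply/eqP; congr p; apply/val_inj.
- by rewrite /tri /=; apply/eqP; congr p; apply/val_inj.
by rewrite /tri /=; apply/eqP; congr p; apply/val_inj; rewrite /= inordK.
Qed.

Lemma sum_bool3 (V : nmodType) (I : finType) (P : pred I) (p q r : I -> bool)
    (E : I -> V) :
  \sum_(s | P s) E s = \sum_(a : bool) \sum_(b : bool) \sum_(c : bool)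
    \sum_(s | P s && [&& p s == a, q s == b & r s == c]) E s.
Proof.
rewrite (partition_big p predT) //; apply: eq_bigr => a _.
rewrite (partition_big q predT) //; apply: eq_bigr => b _.
rewrite (partition_big r predT) //; apply: eq_bigr => c _.
by apply: eq_bigl => s; rewrite !andbA.
Qed.

(* [p] is the pair (A, B) of the recursion. *)
Definition gasket_step (R : nzRingType) (p : R * R) : R * R :=
  (p.1 ^+ 3 + 3 * p.1 * p.2 ^+ 2 + 4 * p.2 ^+ 3,
   p.1 ^+ 2 * p.2 + 4 * p.1 * p.2 ^+ 2 + 3 * p.2 ^+ 3).

(** * Partition functions with prescribed corner spins *)

Section Partition.
Variables (F : fieldType) (y : F).
Hypothesis y0 : y != 0.

Definition bdry_pf (G : cgraph) (b : 'I_3 -> bool) : F :=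
  \sum_(s : config G | [forall j, s (corner G j) == b j]) y ^ spin_sum s.

(** Once every corner of every copy is fixed, the copies are independent and the sum factorises.
    Symmetry of [t] is compatibility with the gluing. *)
Lemma prod_bdry_pf (G : cgraph) (t : 'I_3 -> 'I_3 -> bool) :
  (forall i j, t i j = t j i) ->
  \sum_(s : config (join3 G) |
        [forall i, [forall j, s (in_copy i (corner G j)) == t i j]]) y ^ spin_sum s
  = \prod_i bdry_pf G (t i).
Proof.
(* The product expands into a sum over families of configurations, matched with configurations of
   the join by [amalgam] and [restrict]. *)
move=> tC; rewrite /bdry_pf bigA_distr_big_dep.
rewrite (reindex_onto (@amalgam G) (@restrict G)) /=; last first.
  by move=> s _; rewrite restrictK.
pose Q i (s : config G) := [forall j, s (corner G j) == t i j].
have agree (f : {ffun 'I_3 -> config G}) :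
    f \in family Q ->
    forall i j, f i (corner G j) = t i j.
  by move=> /familyP fF i j; have /forallP/(_ j)/eqP := fF i.
have restr (f : {ffun 'I_3 -> config G}) :
    (forall i j, f i (corner G j) = t i j) -> restrict (amalgam f) = f.
  move=> fT; apply/ffunP => i; apply/ffunP => v.
  by rewrite [restrict _ _]ffunE [LHS]ffunE amalgamE // => k l; rewrite !fT tC.
have sel (f : {ffun 'I_3 -> config G}) :
    [forall i, [forall j, amalgam f (in_copy i (corner G j)) == t i j]]
    && (restrict (amalgam f) == f) =
    (f \in family Q).
  apply/andP/idP => [[/forallP h /eqP <-]|fF].
    apply/familyP => i; rewrite unfold_in; apply/forallP => j.
    by have /forallP/(_ j) := h i; rewrite ![restrict _ _]ffunE ffunE.
  have fT := agree f fF; split; last by rewrite restr.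
  apply/forallP => i; apply/forallP => j; rewrite amalgamE ?fT // => k l.
  by rewrite !fT tC.
apply: eq_big => [f|f]; rewrite sel // => fF.
rewrite spin_sum_join restr; last exact: agree.
by apply: (big_morph _ _ (expr0z _)) => m n; rewrite expfzDr.
Qed.

(** The vertices glued between copies 0 and 1, 0 and 2, 1 and 2 carry the spins [u], [v], [w]. *)
Lemma bdry_pf_join (G : cgraph) (a b c : bool) :
  bdry_pf (join3 G) (tri a b c) =
  \sum_(u : bool) \sum_(v : bool) \sum_(w : bool)
    bdry_pf G (tri a u v) * bdry_pf G (tri u b w) * bdry_pf G (tri v w c).
Proof.
rewrite [LHS](sum_bool3 _ (fun s : config (join3 G) => s (in_copy 0 (corner G 1)))
  (fun s : config (join3 G) => s (in_copy 0 (corner G (inord 2))))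
  (fun s : config (join3 G) => s (in_copy 1 (corner G (inord 2))))).
apply: eq_bigr => u _; apply: eq_bigr => v _; apply: eq_bigr => w _.
(* A symmetric matrix: the free corners [a], [b], [c] on the diagonal, the glued ones off it. *)
pose t (i : 'I_3) := tri (tri a u v i) (tri u b w i) (tri v w c i).
have eqt i : t i =1 nth (fun=> false) [:: tri a u v; tri u b w; tri v w c] i.
  by case: i => [[|[|[|]]]] // ? [[|[|[|]]]].
have ext (d d' : 'I_3 -> bool) : d =1 d' -> bdry_pf G d = bdry_pf G d'.
  by move=> dd'; apply: eq_bigl => s; apply: eq_forallb => j; rewrite dd'.
transitivity (\prod_i bdry_pf G (t i)); last first.
  rewrite !big_ord_recl big_ord0 mulr1 mulrA.
  by congr (_ * _ * _); apply: ext => j; rewrite eqt.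
rewrite -prod_bdry_pf; last by move=> [[|[|[|]]] // ?] [[|[|[|]]] // ?].
apply: eq_bigl => s; rewrite forall_tri /=.
(* Each glued vertex is a corner of two copies, so the nine conditions given by [t] reduce to
   six. *)
have sC i j : s (in_copy i (corner G j)) = s (in_copy j (corner G i)).
  congr (s _); apply/eqP; rewrite in_copyP !eqxx.
  by case: eqVneq => [->|] /=; rewrite ?eqxx ?orbT.
have -> : [forall i, [forall j, s (in_copy i (corner G j)) == t i j]] =
  all (fun i => [forall j, s (in_copy i (corner G j)) == t i j]) [:: 0; 1; inord 2].
  apply/forallP/allP => [h i _|h i]; first exact: h.
  apply: h; rewrite !inE -!val_eqE /= inordK //.
  by case: i => [[|[|[|]]]].
rewrite /= !forall_tri /tri /= inordK //= andbT.
rewrite /join_corner (sC 1 0) (sC (inord 2) 0) (sC (inord 2) 1).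
by do !case: (_ == _).
Qed.

Lemma bdry_pf_triangle (a b c : bool) :
  bdry_pf triangle (tri a b c) = if (a == b) && (b == c) then y ^+ 3 else y^-1.
Proof.
rewrite /bdry_pf (big_pred1 [ffun j => tri a b c j]) => [|s]; last first.
  apply/forallP/eqP => [h|-> j]; last by rewrite ffunE.
  by apply/ffunP => j; rewrite ffunE; apply/eqP/h.
(* The terms are ordered by opposite vertex; they add up to 3 for equal spins and to -1
   otherwise. *)
suff -> : spin_sum ([ffun j => tri a b c j] : config triangle)
    = spin b * spin c + spin a * spin c + spin a * spin b.
  by case: a b c => [] [] [].
rewrite /spin_sum edges_triangle big_imset /=; last first.
  by move=> i j _ _ /setC_inj/set1_inj.
rewrite !big_ord_recl big_ord0 addr0.
rewrite ![\prod_(v in _) _]big_mkcond /=.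
rewrite !big_ord_recl !big_ord0 !inE !ffunE /tri /=.
by rewrite !mulr1 !mul1r addrA.
Qed.

Definition gasket_pair n := iter n (@gasket_step F) (y ^+ 3, y^-1).

Lemma bdry_pf_gasket n (a b c : bool) :
  bdry_pf (sierpinski n) (tri a b c) =
  if (a == b) && (b == c) then (gasket_pair n).1 else (gasket_pair n).2.
Proof.
elim: n a b c => [|n IHn] a b c; first exact: bdry_pf_triangle.
rewrite bdry_pf_join; under eq_bigr do under eq_bigr do under eq_bigr do rewrite !IHn.
rewrite !big_bool /=; case: (gasket_pair n) => p q.
by case: a b c => [] [] [] /=; ring.
Qed.

(** Of the eight assignments of corner spins, two are constant and six are not. *)
Lemma gasketZE n :
  gasketZ n y = 2 * ((gasket_pair n).1 + 3 * (gasket_pair n).2).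
Proof.
transitivity (\sum_(a : bool) \sum_(b : bool) \sum_(c : bool)
    bdry_pf (sierpinski n) (tri a b c)).
  rewrite /gasketZ /partition_function (sum_bool3 _
    (fun s : config (sierpinski n) => s (corner _ 0))
    (fun s => s (corner _ 1)) (fun s => s (corner _ (inord 2)))).
  apply: eq_bigr => a _; apply: eq_bigr => b _; apply: eq_bigr => c _.
  by apply: eq_bigl => s; rewrite forall_tri.
rewrite !big_bool !bdry_pf_gasket /=; ring.
Qed.

End Partition.

(** * The iterated step as an integral form of degree [3 ^ n] *)

Lemma iter_step_rmorph (R S : nzRingType) (phi : {rmorphism R -> S}) n (p : R * R) :
  iter n (@gasket_step S) (phi p.1, phi p.2) =
  (phi (iter n (@gasket_step R) p).1, phi (iter n (@gasket_step R) p).2).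
Proof.
elim: n => //= n ->; rewrite /gasket_step /=.
by rewrite !(rmorphD, rmorphM, rmorphXn, rmorph_nat).
Qed.

Lemma iter_step_homog (R : comNzRingType) n (c a b : R) :
  iter n (@gasket_step R) (c * a, c * b) =
  (c ^+ (3 ^ n) * (iter n (@gasket_step R) (a, b)).1,
   c ^+ (3 ^ n) * (iter n (@gasket_step R) (a, b)).2).
Proof.
elim: n => [|n IHn]; first by rewrite expr1.
rewrite !iterS IHn expnSr exprM; case: (iter n _ _) => p q.
by rewrite /gasket_step /=; congr (_, _); ring.
Qed.

Definition gasket_form (R : nzRingType) n (a b : R) : R :=
  let p := iter n (@gasket_step R) (a, b) in p.1 + 3 * p.2.

Lemma gasket_form_homog (R : comNzRingType) n (c a b : R) :
  gasket_form n (c * a) (c * b) = c ^+ (3 ^ n) * gasket_form n a b.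
Proof. by rewrite /gasket_form iter_step_homog /=; ring. Qed.

Lemma gasket_form_rec (F : fieldType) n (x : F) : x + 1 != 0 -> x + 3 != 0 ->
  gasket_form n.+1 x 1 =
  gasket_form n ((x ^+ 2 - x + 4) / (x + 3)) 1 * ((x + 1) * (x + 3)) ^+ (3 ^ n).
Proof.
(* Homogeneity moves the factor into the arguments, and the first step, not the last, is peeled off;
   only the two starting pairs remain to be compared. *)
move=> x1 x3; rewrite [RHS]mulrC -gasket_form_homog /gasket_form iterSr.
rewrite /gasket_step /=; set u := (_, _); set v := (_, _).
by have -> : u = v by rewrite /u /v; congr (_, _); field.
Qed.

(** * The polynomials M_n *)

Definition gasket_poly n : {poly rat} := gasket_form n 'X 1.

Lemma polyOver_gasket_form (R : nzRingType) (S : semiringClosed R) n :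
  gasket_form n 'X 1 \is a @polyOver R S.
Proof.
rewrite /gasket_form.
suff [] : (iter n (@gasket_step {poly R}) ('X, 1)).1 \is a polyOver S /\
  (iter n (@gasket_step {poly R}) ('X, 1)).2 \is a polyOver S.
  by move=> h1 h2; rewrite rpredD ?rpredM ?rpred_nat.
elim: n => [|n [h1 h2]]; first by rewrite polyOverX rpred1.
by rewrite iterS /gasket_step /=; split; rewrite !rpredD ?rpredM ?rpredX ?rpred_nat.
Qed.

Lemma coef_gasket_poly_int n i : (gasket_poly n)`_i \is a Num.int.
Proof. by move: i; apply/polyOverP/polyOver_gasket_form. Qed.

(** Substituting [r] is a ring morphism sending ['X] to [r], hence commutes with the iterated
    step. *)
Lemma ratsubst_gasket n (r : ratfun) : ratsubst (gasket_poly n) r = gasket_form n r 1.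
Proof.
pose phi : {rmorphism {poly rat} -> ratfun} :=
  horner_eval r \o map_poly (@tofrac {poly rat} \o polyC).
rewrite -[LHS]/(phi _) rmorphD rmorphM rmorph_nat.
have := iter_step_rmorph phi n ('X, 1).
rewrite /= {1 2}/horner_eval map_polyX hornerX rmorph1 hornerC /gasket_form => -> //.
Qed.

Lemma ratsubst_tofrac (p q : {poly rat}) : ratsubst p (tofrac q) = tofrac (p \Po q).
Proof. by rewrite /ratsubst map_poly_comp horner_map. Qed.

Lemma indet_neq0 : indet != 0.
Proof. by rewrite /indet tofrac_eq0 polyX_eq0. Qed.

Lemma gasketZ_poly n :
  indet ^+ (3 ^ n) * gasketZ n indet = 2 * ratsubst (gasket_poly n) (indet ^+ 4).
Proof.
rewrite gasketZE ?indet_neq0 // mulrCA ratsubst_gasket.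
(* The power of y is absorbed by scaling (y^3, y^-1) by y, which gives (y^4, 1). *)
rewrite -[_ + _]/(gasket_form n (indet ^+ 3) indet^-1) -gasket_form_homog.
by rewrite -exprS divff ?indet_neq0.
Qed.

Theorem theorem1p2 :
  (forall n : nat, exists P : {poly rat},
      P \is a polyOver Num.int
      /\ indet ^+ (3 ^ n) * gasketZ n indet = ratsubst P (indet ^+ 4))
  /\
  (forall M : nat -> {poly rat},
      (forall n : nat,
          ratsubst (M n) (indet ^+ 4) = indet ^+ (3 ^ n) * gasketZ n indet / 2) ->
      (forall n : nat, M n \is a polyOver Num.int)
      /\
      (forall n : nat, (1 <= n)%N ->
          let x := indet in
          let f := (x ^+ 2 - x + 4) / (x + 3) in
          ratsubst (M n) x
            = ratsubst (M n.-1) f * ((x + 1) * (x + 3)) ^+ (3 ^ n.-1))).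
Proof.
split=> [n|M defM].
  exists (gasket_poly n *+ 2); split.
    by apply/polyOverP => i; rewrite coefMn rpredMn ?coef_gasket_poly_int.
  by rewrite gasketZ_poly /indet -tofracXn !ratsubst_tofrac raddfMn tofracMn mulr_natl.
have two0 : 2 != 0 :> ratfun.
  by rewrite -(rmorph_nat (@tofrac {poly rat})) tofrac_eq0 -polyC_natr polyC_eq0.
(* The defining equation determines [M n], because composing polynomials with ['X^4] is
   injective. *)
have MP n : M n = gasket_poly n.
  have := defM n; rewrite gasketZ_poly mulrAC divff // mul1r /indet -tofracXn.
  rewrite !ratsubst_tofrac => /eqP; rewrite tofrac_eq -subr_eq0 -rmorphB.
  by rewrite comp_poly_eq0 ?size_polyXn // subr_eq0 => /eqP.
split=> [n|[//|n] _ x f].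
  by rewrite MP; apply/polyOverP => i; apply: coef_gasket_poly_int.
(* x + 1 and x + 3 are nonzero rational functions, being polynomials of size 2. *)
rewrite !MP !ratsubst_gasket /=; apply: gasket_form_rec.
  by rewrite -tofrac1 -tofracD tofrac_eq0 -size_poly_eq0 size_XaddC.
rewrite -(rmorph_nat (@tofrac {poly rat})) -tofracD tofrac_eq0 -polyC_natr.
by rewrite -size_poly_eq0 size_XaddC.
Qed.
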